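(* Let $K\subset\mathbb{R}^n$ be an $n$-attractor with associated IFS $\{s_1,\dots,s_M\}$ having contraction factors $\rho_1,\dots,\rho_M$, let $\Omega:=K^\circ$ and $\rho_{\rm min}:=\min_{i=1,\dots,M}\rho_i$. Suppose that $h\in(0,\operatorname{diam}(\Omega)]$. Then $\{\Omega_{\bm m}\}_{\bm m\in L_h(\Omega)}$ is a mesh of $\Omega$. Furthermore, the elements of the mesh satisfy $$\rho_{\rm min}h<\operatorname{diam}(\Omega_{\bm m})\le h,\qquad\bm m\in L_h(\Omega),$$ and $$\left(\frac{\rho_{\rm min}h}{\operatorname{diam}(\Omega)}\right)^n|\Omega|\le|\Omega_{\bm m}|\le\left(\frac{h}{\operatorname{diam}(\Omega)}\right)^n|\Omega|,\qquad\bm m\in L_h(\Omega),$$ and the number of elements $N=\#L_h(\Omega)$ in the mesh satisfies $$\left(\frac{\operatorname{diam}(\Omega)}{h}\right)^n\le N<\left(\frac{\operatorname{diam}(\Omega)}{\rho_{\rm min}h}\right)^n .$$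
   Context: **$n$-attractor.** Let $n,M\in\mathbb{N}$, $M\ge2$. An IFS is a collection $\{s_1,\dots,s_M\}$ of contracting similarities $s_i(x)=\rho_iA_ix+\delta_i$ on $\mathbb{R}^n$ with $\rho_i\in(0,1)$, $A_i$ orthogonal, $\delta_i\in\mathbb{R}^n$; its attractor is the unique non-empty compact $K$ with $K=\bigcup_is_i(K)$. The open set condition (OSC) holds if there is a non-empty open $O$ with $\bigcup_is_i(O)\subset O$ and $s_i(O)\cap s_j(O)=\emptyset$ for $i\neq j$. $K$ is an $n$-attractor if it is the attractor of an IFS satisfying the OSC with $\sum_i\rho_i^n=1$. Known facts: $\Omega\neq\emptyset$, $\overline\Omega=K$, $|\partial\Omega|=0$, the OSC holds with $O=\Omega$, and $|s_i(K)\cap s_j(K)|=0$ for $i\ne j$. **Indices.** $\mathcal{I}:=\{\emptyset\}\cup\bigcup_{l\in\mathbb{N}}\{1,\dots,M\}^l$; for $\bm m=(m_1,\dots,m_l)$, $s_{\bm m}:=s_{m_1}\circ\cdots\circ s_{m_l}$ and $\Omega_{\bm m}:=s_{\bm m}(\Omega)$; $\Omega_\emptyset:=\Omega$. $L_h(\Omega):=\{\emptyset\}$ when $h\ge\operatorname{diam}(\Omega)$, and for $h<\operatorname{diam}(\Omega)$, $L_h(\Omega):=\{\bm m=(m_1,\dots,m_l)\in\mathcal{I}:\operatorname{diam}(\Omega_{\bm m})\le h\text{ and }\operatorname{diam}(\Omega_{(m_1,\dots,m_{l-1})})>h\}$, where $\Omega_{(m_1,\dots,m_{l-1})}$ is replaced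 by $\Omega$ when $l=1$. **Mesh.** A mesh of $\Omega$ is a finite collection $\mathcal{T}$ of non-empty bounded open subsets of $\Omega$ that are pairwise disjoint and satisfy $|\Omega\setminus\bigcup_{T\in\mathcal{T}}T|=0$. $|\cdot|$ is Lebesgue measure. *)

(* Defs.v *)
From HB Require Import structures.
From mathcomp Require Import all_boot all_order all_algebra.
From mathcomp Require Import all_classical all_reals all_analysis.
Set Implicit Arguments.
Unset Strict Implicit.
Unset Printing Implicit Defensive.
Import Order.TTheory GRing.Theory Num.Theory.
Import numFieldNormedType.Exports.
Local Open Scope classical_set_scope.
Local Open Scope ring_scope.

(* R^n is 'rV[R]_n.  The library norm on 'rV[R]_n is the sup norm: it yields the
   usual topology and bounded sets, but not the Euclidean diameter. *)
Definition enorm (R : realType) (n : nat) (x : 'rV[R]_n) : R :=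
  Num.sqrt (\sum_(i < n) x 0 i ^+ 2).

Definition diam (R : realType) (n : nat) (A : set 'rV[R]_n) : R :=
  sup [set d | exists x y, [/\ A x, A y & d = enorm (x - y)]].

(* The half-open box \prod_i ]a_i, b_i]. *)
Definition box (R : realType) (n : nat) (a b : 'rV[R]_n) : set 'rV[R]_n :=
  [set x | forall i, a 0 i < x 0 i <= b 0 i].

(* n-dimensional Lebesgue (outer) measure, defined on all subsets; on Lebesgue
   measurable sets, in particular Borel sets, it is Lebesgue measure. *)
Definition leb (R : realType) (n : nat) (A : set 'rV[R]_n) : \bar R :=
  ereal_inf [set v : \bar R | exists a b : nat -> 'rV[R]_n,
    [/\ forall k i, a k 0 i <= b k 0 i,
        A `<=` \bigcup_k box (a k) (b k)
      & v = (\sum_(0 <= k <oo) (\prod_(i < n) (b k 0 i - a k 0 i))%:E)%E]].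

Record contracting_similarity (R : realType) (n : nat) := ContractingSimilarity {
  ratio : R ;
  orth : 'M[R]_n ;
  shift : 'rV[R]_n ;
  ratio_gt0 : 0 < ratio ;
  ratio_lt1 : ratio < 1 ;
  orth_orthogonal : orth *m orth^T = 1%:M }.

(* Points are row vectors, so the action x |-> A x of A reads x *m A^T. *)
Definition sim_fun (R : realType) (n : nat) (s : contracting_similarity R n)
    (x : 'rV[R]_n) : 'rV[R]_n :=
  ratio s *: (x *m (orth s)^T) + shift s.

Coercion sim_fun : contracting_similarity >-> Funclass.

Definition is_attractor (R : realType) (n M : nat)
    (s : 'I_M -> contracting_similarity R n) (K : set 'rV[R]_n) : Prop :=
  [/\ K !=set0, compact K & K = \bigcup_i (s i @` K)].

Definition open_set_condition (R : realType) (n M : nat)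
    (s : 'I_M -> contracting_similarity R n) : Prop :=
  exists O : set 'rV[R]_n,
    [/\ O !=set0, open O, \bigcup_i (s i @` O) `<=` O
      & forall i j, i != j -> s i @` O `&` s j @` O = set0].

Definition is_n_attractor (R : realType) (n M : nat)
    (s : 'I_M -> contracting_similarity R n) (K : set 'rV[R]_n) : Prop :=
  [/\ is_attractor s K, open_set_condition s
    & \sum_(i < M) ratio (s i) ^+ n = 1].

(* The default value 1 is harmless, since all ratios are smaller than 1. *)
Definition ratio_min (R : realType) (n M : nat)
    (s : 'I_M -> contracting_similarity R n) : R :=
  \big[Num.min/1]_(i < M) ratio (s i).

Definition word_map (R : realType) (n M : nat)
    (s : 'I_M -> contracting_similarity R n) (m : seq 'I_M) :
    'rV[R]_n -> 'rV[R]_n :=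
  foldr (fun i f => s i \o f) id m.

Definition piece (R : realType) (n M : nat)
    (s : 'I_M -> contracting_similarity R n) (Om : set 'rV[R]_n)
    (m : seq 'I_M) : set 'rV[R]_n :=
  word_map s m @` Om.

Definition Lh (R : realType) (n M : nat)
    (s : 'I_M -> contracting_similarity R n) (Om : set 'rV[R]_n) (h : R) :
    set (seq 'I_M) :=
  if diam Om <= h then [set [::]]
  else [set m | exists w i, [/\ m = rcons w i,
                                diam (piece s Om m) <= h
                              & h < diam (piece s Om w)]].

Definition is_mesh (R : realType) (n : nat) (Om : set 'rV[R]_n)
    (TT : set (set 'rV[R]_n)) : Prop :=
  [/\ finite_set TT,
      forall T, TT T -> [/\ T !=set0, bounded_set T, open T & T `<=` Om],
      forall T T', TT T -> TT T' -> T <> T' -> T `&` T' = set0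
    & leb (Om `\` \bigcup_(T in TT) T) = 0%E].

(* Main.v *)
Require Import Defs.
From HB Require Import structures.
From mathcomp Require Import all_boot all_order all_algebra.
From mathcomp Require Import all_classical all_reals all_analysis.
From mathcomp Require Import ring lra.
Import Order.TTheory GRing.Theory Num.Theory.
Import numFieldNormedType.Exports.
Local Open Scope classical_set_scope.
Local Open Scope ring_scope.

Set Implicit Arguments.
Unset Strict Implicit.
Unset Printing Implicit Defensive.

(** Write [d] for the diameter of [Om], the interior of [K], and [rho m] for
    the product of the ratios along a word [m]; since [d >= h > 0], [Om] is not
    empty. The piece of [m] is the image of [Om] under a similarity of ratio
    [rho m], so its diameter is [rho m * d] ([diam_piece]) and its measure is
    [rho m ^+ n] times that of [Om] ([leb_piece]). Hence the words of [Lh] form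
    a cut set: they are the words at which the ratio first drops to [h / d] or
    below ([Lh_cutset]), so that [rho_min * (h / d) < rho m <= h / d]. Both
    two-sided estimates follow at once.

    A cut set is either [{[::]}] or, sorted by first letter [i], the union of
    the cut sets for the thresholds [(h / d) / rho i], each with [i] prepended
    ([cutset_cons], [cutset_ind]). By induction along this decomposition:
    - the cut set is finite and, because the [n]-th powers of the ratios of the
      system sum to [1], so do those of its words ([cutset_enum]); with the
      bounds on [rho m] this gives the bounds on the number of words;
    - its pieces are disjoint ([disjoint_pieces]) and cover [Om] up to a null
      set ([leb_complement_cutset]), provided that this is so for the images
      of [Om] under the maps [s i].

    These images are disjoint by the open set condition, for an arbitrary open
    set [O] satisfying it: [K] lies in the closure of [O]
    ([disjoint_interior_attractor]). They cover [Om] up to a null set because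
    they are disjoint subsets of [Om] whose measures sum to the finite measure
    of [Om] ([leb_complement_first_level]).

    Measure theory enters through two facts about [leb], seen as an outer
    measure: open sets are Caratheodory measurable ([caratheodory_open]), and a
    similarity of ratio [r] multiplies [leb] by [r ^+ n] ([leb_similarity]).
    The second fact is clear for homotheties. A rotation multiplies [leb] on
    cubes by a constant [c], hence on all sets by at most [c], and invariance of
    the Euclidean ball forces [c <= 1] ([leb_rotation_cube]); the inverse
    similarity gives the converse inequality. *)

(* The libraries imported above use these two names for other notions. *)
Local Notation ratio := Defs.ratio.
Local Notation shift := Defs.shift.

(** * Lebesgue outer measure *)

(** The volume of the box with corners [a] and [b]. *)
Definition box_volume (R : realType) (n : nat) (a b : 'rV[R]_n) : R :=
  \prod_(i < n) (b 0 i - a 0 i).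

Section LebesgueOuterMeasure.
Variables (R : realType) (n' : nat).
Local Notation n := n'.+1.
Local Notation V := 'rV[R]_n.
Implicit Types (a b x y t : V) (A U : set V).

Lemma box_volume_ge0 a b :
  (forall i, a 0 i <= b 0 i) -> 0 <= box_volume a b.
Proof. by move=> ab; apply: prodr_ge0 => i _; rewrite subr_ge0. Qed.

Lemma leb_le_cover (a b : nat -> V) A :
    (forall k i, a k 0 i <= b k 0 i) ->
    A `<=` \bigcup_k box (a k) (b k) ->
  (leb A <= \sum_(0 <= k <oo) (box_volume (a k) (b k))%:E)%E.
Proof. by move=> ab Aab; apply: ereal_inf_lbound; exists a, b. Qed.

Lemma leb_ge0 A : (0 <= leb A)%E.
Proof.
apply: le_ereal_inf_tmp => _ [a [b [ab _ ->]]].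
by apply: nneseries_ge0 => k _ _; rewrite lee_fin box_volume_ge0.
Qed.

Lemma le_leb A B : A `<=` B -> (leb A <= leb B)%E.
Proof.
move=> AB; apply: le_ereal_inf_tmp => _ [a [b [ab Bab ->]]].
exact: leb_le_cover (subset_trans AB Bab).
Qed.

Lemma leb_box a b :
  (forall i, a 0 i <= b 0 i) -> (leb (box a b) <= (box_volume a b)%:E)%E.
Proof.
move=> ab; pose b' k := if k is 0%N then b else a.
apply: le_trans (@leb_le_cover (fun=> a) b' _ _ _) _.
- by case=> [|k] i /=.
- by move=> x abx; exists 0%N.
rewrite nneseries_recl//; last first.
  by case=> [|k] _; rewrite lee_fin box_volume_ge0 /=.
rewrite eseries_cond eseries0 ?adde0// => -[|k]// _ _ /=.
by rewrite /box_volume big_ord_recl subrr mul0r.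
Qed.

Lemma leb0 : leb (set0 : set V) = 0%E.
Proof.
apply/eqP; rewrite eq_le leb_ge0 andbT.
apply: (@le_trans _ _ (leb (box (0 : V) 0))); first exact: le_leb.
apply: le_trans (leb_box _) _ => //.
by rewrite /box_volume big_ord_recl subrr mul0r.
Qed.

Lemma leb_cover_adherent A (e : R) : 0 < e -> leb A \is a fin_num ->
  exists a b : nat -> V,
    [/\ forall k i, a k 0 i <= b k 0 i, A `<=` \bigcup_k box (a k) (b k)
      & (\sum_(0 <= k <oo) (box_volume (a k) (b k))%:E <= leb A + e%:E)%E].
Proof.
move=> e0 /(lb_ereal_inf_adherent e0)[_ [a [b [ab Aab ->]]] lt].
by exists a, b; split=> //; exact: ltW.
Qed.

Lemma leb_sigma_subadditive : sigma_subadditive (@leb R n).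
Proof.
move=> F; have [[i Foo]|Ffin] := pselect (exists i, leb (F i) = +oo%E).
  rewrite (@eseries_pinfty _ _ xpredT i) ?leey// => k _.
  by rewrite -ltNye (lt_le_trans _ (leb_ge0 _)).
have {}Ffin i : leb (F i) \is a fin_num.
  rewrite ge0_fin_numE ?leb_ge0// ltey.
  by apply/eqP => Foo; apply: Ffin; exists i.
apply/lee_addgt0Pr => e e0.
apply: le_trans (epsilon_trick _ _ (ltW e0)); last by move=> k; exact: leb_ge0.
pose P i (ab : (nat -> V) * (nat -> V)) :=
  [/\ forall k j, ab.1 k 0 j <= ab.2 k 0 j,
      F i `<=` \bigcup_k box (ab.1 k) (ab.2 k)
    & (\sum_(0 <= k <oo) (box_volume (ab.1 k) (ab.2 k))%:E
        <= leb (F i) + (e / (2 ^ i.+1)%:R)%:E)%E].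
have [G PG] : {G & forall i, P i (G i)}.
  apply: choice => i; have e'0 : 0 < e / (2 ^ i.+1)%:R.
    by rewrite divr_gt0// ltr0n expn_gt0.
  by have [a [b [? ? ?]]] := leb_cover_adherent e'0 (Ffin i); exists (a, b).
pose v (ij : nat * nat) : \bar R :=
  (box_volume ((G ij.1).1 ij.2) ((G ij.1).2 ij.2))%:E.
have v0 ij : (0 <= v ij)%E.
  by rewrite lee_fin box_volume_ge0//; case: (PG ij.1).
have /card_esym/ppcard_eqP[f] := card_nat2.
apply: (@le_trans _ _ (\esum_(ij in [set: nat * nat]) v ij)).
  rewrite (reindex_esum setT setT f) //= -nneseries_esumT//.
  apply: (@leb_le_cover (fun k => (G (f k).1).1 (f k).2)
    (fun k => (G (f k).1).2 (f k).2)).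
    by move=> k j; case: (PG (f k).1).
  move=> x [i _ Fix]; have [_ /(_ _ Fix)[j _ xij] _] := PG i.
  by exists (f^-1%FUN (i, j)) => //=; rewrite invK ?inE.
have -> : (\esum_(ij in [set: nat * nat]) v ij =
    \sum_(0 <= i <oo) \sum_(0 <= j <oo) v (i, j))%E.
  rewrite nneseries_esumT; last first.
    by move=> i; apply: nneseries_ge0 => *; exact: v0.
  under [in RHS]eq_esum => i _ do rewrite nneseries_esumT//.
  rewrite esum_esum//.
  by congr (esum _ _); apply/seteqP; split.
apply: lee_nneseries => i *; first by apply: nneseries_ge0 => *; exact: v0.
by case: (PG i).
Qed.

HB.instance Definition _ := isOuterMeasure.Build R V (@leb R n)
  leb0 leb_ge0 le_leb leb_sigma_subadditive.

Lemma leb_bigsetU (I : Type) (r : seq I) (P : pred I) (F : I -> set V) :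
  (leb (\big[setU/set0]_(i <- r | P i) F i) <=
   \sum_(i <- r | P i) leb (F i))%E.
Proof.
elim/big_rec2: _ => [|i x X _ le]; first by rewrite leb0.
exact: le_trans (outer_measureU2 _ _ _) (leeD2l _ le).
Qed.

Lemma leb_null_bigsetU (I : Type) (r : seq I) (P : pred I) (F : I -> set V) :
    (forall i, P i -> leb (F i) = 0%E) ->
  leb (\big[setU/set0]_(i <- r | P i) F i) = 0%E.
Proof.
move=> F0; apply/eqP; rewrite eq_le leb_ge0 andbT.
by apply: le_trans (leb_bigsetU _ _ _) _; rewrite big1.
Qed.

End LebesgueOuterMeasure.

(** * Measurability of open sets *)

Section Caratheodory.
Variables (R : realType) (n' : nat).
Local Notation n := n'.+1.
Local Notation V := 'rV[R]_n.
Implicit Types (a b x y t : V) (A U : set V).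

(** Cutting a box along a coordinate hyperplane splits its volume, so a cover
    of [X] splits into covers of both parts of [X] with the same total
    volume. *)
Lemma caratheodory_halfspace (i : 'I_n) (c : R) :
  caratheodory_measurable (@leb R n) [set x : V | x 0 i <= c].
Proof.
apply: le_caratheodory_measurable => X.
apply: le_ereal_inf_tmp => _ [a [b [ab Xab ->]]].
(* The cutting value is clamped to the extent of the box, so that both parts
   remain boxes, possibly of zero volume. *)
pose tau k := Num.max (a k 0 i) (Num.min (b k 0 i) c).
have atau k : a k 0 i <= tau k by rewrite /tau le_max lexx.
have taub k : tau k <= b k 0 i by rewrite /tau ge_max ab ge_min lexx.
pose upd (v : V) (r : R) : V := \row_j if j == i then r else v 0 j.
have upd_i v r : upd v r 0 i = r by rewrite mxE eqxx.
have upd_j v r j : j != i -> upd v r 0 j = v 0 j by rewrite mxE => /negPf ->.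
have ab' k j : a k 0 j <= upd (b k) (tau k) 0 j.
  by have [->|ji] := eqVneq j i; rewrite ?upd_i ?upd_j.
have a'b k j : upd (a k) (tau k) 0 j <= b k 0 j.
  by have [->|ji] := eqVneq j i; rewrite ?upd_i ?upd_j.
apply: (@le_trans _ _
    (\sum_(0 <= k <oo) (box_volume (a k) (upd (b k) (tau k)))%:E
   + \sum_(0 <= k <oo) (box_volume (upd (a k) (tau k)) (b k))%:E)%E).
  apply: leeD; apply: leb_le_cover => // x [/Xab[k _ abx]] /= xi;
    exists k => // j; have /andP[lt le] := abx i;
    have [->|ji] := eqVneq j i; rewrite ?upd_i ?upd_j//;
    rewrite ?(abx j) ?lt ?le ?andbT//.
    by rewrite /tau le_max le_min le xi orbT.
  move/negP: xi; rewrite -ltNge => xi.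
  by rewrite /tau gt_max lt gt_min xi orbT.
rewrite -nneseriesD; [|by move=> k _; rewrite lee_fin box_volume_ge0..].
rewrite le_eqVlt; apply/orP; left; apply/eqP.
apply: eq_eseriesr => k _; rewrite -EFinD; congr _%:E.
rewrite /box_volume (bigD1 i)//= [X in _ + X](bigD1 i)//=.
rewrite [RHS](bigD1 i)//= !upd_i.
rewrite (eq_bigr (fun j => b k 0 j - a k 0 j)); last first.
  by move=> j ji; rewrite upd_j.
rewrite [X in _ + _ * X](eq_bigr (fun j => b k 0 j - a k 0 j)); last first.
  by move=> j ji; rewrite upd_j.
by rewrite -mulrDl addrC addrA subrK.
Qed.

Lemma caratheodory_box a b : caratheodory_measurable (@leb R n) (box a b).
Proof.
suff boxP (r : seq 'I_n) : caratheodory_measurable (@leb R n)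
    [set x : V | forall i, i \in r -> a 0 i < x 0 i <= b 0 i].
  have := boxP (index_enum 'I_n); congr caratheodory_measurable.
  apply/seteqP; split=> x abx i; last by move=> _; exact: abx.
  by apply: abx; rewrite mem_index_enum.
elim: r => [|i r IH].
  rewrite (_ : mkset _ = setT); last by apply/seteqP; split.
  by move=> X; rewrite setIT setCT setI0 leb0 adde0.
rewrite (_ : mkset _ = ([set x : V | x 0 i <= b 0 i] `\`
    [set x : V | x 0 i <= a 0 i]) `&`
    [set x : V | forall i, i \in r -> a 0 i < x 0 i <= b 0 i]).
  apply: caratheodory_measurable_setI => //.
  by apply: caratheodory_measurable_setD; exact: caratheodory_halfspace.
apply/seteqP; split=> x /=.
  move=> abx; split; last by move=> j jr; apply: abx; rewrite inE jr orbT.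
  have /andP[lt le] := abx i (mem_head _ _).
  by split=> //; apply/negP; rewrite -ltNge.
move=> [[le /negP]]; rewrite -ltNge => lt abx j; rewrite inE.
by case/predU1P => [->|/abx//]; rewrite lt le.
Qed.

Lemma open_coordP U : open U <-> forall x, U x -> exists2 e, 0 < e &
  forall y, (forall i, `|x 0 i - y 0 i| < e) -> U y.
Proof.
rewrite openE; split=> [Uo x /Uo|Uo x /Uo[e e0 xU]].
  move=> /nbhs_ballP[e e0 xU]; exists e => // y xy; apply: xU; split=> // i j.
  by rewrite ord1; exact: xy.
apply/nbhs_ballP; exists e => // y [_ xy]; apply: xU => i; exact: xy.
Qed.

(** An open set is the countable union of the rational boxes it contains. *)
Lemma caratheodory_open U : open U -> caratheodory_measurable (@leb R n) U.
Proof.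
move=> /open_coordP Uo.
pose rbox (ab : 'rV[rat]_n * 'rV[rat]_n) : set V :=
  box (map_mx ratr ab.1) (map_mx ratr ab.2).
pose F k : set V := if unpickle k is Some ab then
  if `[< rbox ab `<=` U >] then rbox ab else set0 else set0.
suff -> : U = \bigcup_k F k.
  apply: caratheodory_measurable_bigcup => k; rewrite /F.
  case: unpickle => [ab|]; last exact: caratheodory_measurable_set0.
  by case: ifP => _; [exact: caratheodory_box|
    exact: caratheodory_measurable_set0].
apply/seteqP; split=> [x Ux|x [k _]]; last first.
  by rewrite /F; case: unpickle => // ab; case: asboolP => // sub /sub.
have [e e0 xU] := Uo x Ux.
have /choice[a aP] i : exists q : rat, x 0 i - e < ratr q < x 0 i.
  have /rat_in_itvoo[q qP] : x 0 i - e < x 0 i by rewrite ltrBlDr ltrDl.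
  by exists q; rewrite in_itv in qP.
have /choice[b bP] i : exists q : rat, x 0 i < ratr q < x 0 i + e.
  have /rat_in_itvoo[q qP] : x 0 i < x 0 i + e by rewrite ltrDl.
  by exists q; rewrite in_itv in qP.
pose ab := (\row_i a i, \row_i b i).
exists (pickle ab) => //; rewrite /F pickleK.
case: asboolP => [_|[]].
  move=> i; rewrite !mxE.
  by have /andP[_ ->] := aP i; have /andP[/ltW-> _] := bP i.
move=> y yab; apply: xU => i; have := yab i; rewrite !mxE.
have := aP i; have := bP i => /andP[? ?] /andP[? ?] /andP[? ?].
by rewrite ltr_norml; apply/andP; split; lra.
Qed.

End Caratheodory.

(** * The Euclidean norm *)

Section EuclideanNorm.
Variables (R : realType) (n : nat).
Local Notation V := 'rV[R]_n.
Implicit Types (x y : V) (U : set V).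

Lemma enorm_ge0 x : 0 <= enorm x.
Proof. exact: sqrtr_ge0. Qed.

Lemma sqr_enorm x : enorm x ^+ 2 = \sum_(i < n) x 0 i ^+ 2.
Proof. by rewrite sqr_sqrtr// sumr_ge0// => i _; exact: sqr_ge0. Qed.

Lemma enormZ (r : R) x : 0 <= r -> enorm (r *: x) = r * enorm x.
Proof.
move=> r0; apply/eqP; rewrite -(@eqrXn2 _ 2) ?enorm_ge0 ?mulr_ge0 ?enorm_ge0//.
rewrite exprMn !sqr_enorm mulr_sumr; apply/eqP/eq_bigr => i _.
by rewrite mxE exprMn.
Qed.

Lemma enorm_mul_orthogonal (Q : 'M[R]_n) x :
  Q *m Q^T = 1%:M -> enorm (x *m Q) = enorm x.
Proof.
move=> QQ; rewrite /enorm; congr Num.sqrt.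
have sqE (y : V) : \sum_(i < n) y 0 i ^+ 2 = (y *m y^T) 0 0.
  by rewrite mxE; apply: eq_bigr => i _; rewrite mxE expr2.
by rewrite !sqE trmx_mul mulmxA -(mulmxA x) QQ mulmx1.
Qed.

Lemma ler_coord_enorm x i : `|x 0 i| <= enorm x.
Proof.
rewrite -(@ler_pXn2r _ 2) ?nnegrE ?enorm_ge0// real_normK ?num_real//.
rewrite sqr_enorm (bigD1 i)//= lerDl sumr_ge0// => j _; exact: sqr_ge0.
Qed.

Lemma enorm_le_sum x : enorm x <= \sum_(i < n) `|x 0 i|.
Proof.
have s0 (r : seq 'I_n) : 0 <= \sum_(i <- r) `|x 0 i| by exact: sumr_ge0.
rewrite -(@ler_pXn2r _ 2) ?nnegrE ?enorm_ge0// sqr_enorm.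
elim: (index_enum _) => [|i r IH]; first by rewrite !big_nil expr0n.
rewrite !big_cons sqrrD real_normK ?num_real// -addrA lerD2l.
by rewrite (le_trans IH)// lerDr mulrn_wge0// mulr_ge0.
Qed.

Lemma enorm_continuous : continuous (@enorm R n).
Proof.
move=> x; apply: continuous_comp; last exact: sqrt_continuous.
apply: continuous_big; first exact: add_continuous.
move=> i _ y; apply: (@continuous_comp _ _ _ (fun y : V => y 0 i)
  (fun r : R => r ^+ 2)).
  exact: coord_continuous.
exact: exprn_continuous.
Qed.

Lemma open_enormP U : open U <-> forall x, U x -> exists2 e, 0 < e &
  forall y, enorm (y - x) < e -> U y.
Proof.
rewrite openE; split=> Uo x Ux.
  have /nbhs_ballP[e e0 xU] := Uo x Ux; exists e => // y xy; apply: xU.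
  split=> // i j; rewrite ord1 /ball/= distrC (le_lt_trans _ xy)//.
  by have := ler_coord_enorm (y - x) j; rewrite !mxE.
have [e e0 xU] := Uo x Ux; apply/nbhs_ballP; exists (e / n.+1%:R).
  by rewrite /= divr_gt0// ltr0n.
move=> y [_ xy]; apply: xU; apply: le_lt_trans (enorm_le_sum _) _.
apply: (@le_lt_trans _ _ (\sum_(i < n) e / n.+1%:R)).
  apply: ler_sum => i _; apply: ltW; have := xy 0 i.
  by rewrite /ball/= distrC !mxE.
rewrite sumr_const card_ord -(mulr_natr (e / _)) mulrAC.
by rewrite ltr_pdivrMr ?ltr0n// ltr_pM2l// ltr_nat.
Qed.

End EuclideanNorm.

(** * Outer measure of images, homotheties and grids of cubes *)

Section Similarities.
Variables (R : realType) (n' : nat).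
Local Notation n := n'.+1.
Local Notation V := 'rV[R]_n.
Implicit Types (a b x y t : V) (A B : set V) (Q : 'M[R]_n).

Lemma leb_le_sum (I : choiceType) (r : seq I) (P : pred I) (F : I -> set V) A :
    (forall x, A x -> exists i, [/\ i \in r, P i & F i x]) ->
  (leb A <= \sum_(i <- r | P i) leb (F i))%E.
Proof.
move=> AF; apply: le_trans (leb_bigsetU _ _ _); apply: le_leb => x Ax.
rewrite -bigcup_seq_cond; have [i [ir Pi Fix]] := AF _ Ax.
by exists i => //=; rewrite ir.
Qed.

(** A map increases the outer measure by at most the factor by which it
    increases the outer measure of boxes. *)
Lemma leb_image_le (f : V -> V) (c : R) A : 0 < c ->
    (forall a b, (forall i, a 0 i <= b 0 i) ->
      (leb (f @` box a b) <= (c * box_volume a b)%:E)%E) ->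
  (leb (f @` A) <= c%:E * leb A)%E.
Proof.
move=> c0 fbox; rewrite -lee_pdivrMl//.
apply: le_ereal_inf_tmp => _ [a [b [ab Aab ->]]]; rewrite lee_pdivrMl//.
rewrite -nneseriesZl; last by move=> k _; rewrite lee_fin box_volume_ge0.
apply: (@le_trans _ _ (\sum_(0 <= k <oo) leb (f @` box (a k) (b k)))%E).
  apply: le_trans (leb_sigma_subadditive _); apply: le_leb.
  by move=> _ [x /Aab[k _ abx] <-]; exists k => //; exists x.
by apply: lee_nneseries => k *; [exact: leb_ge0|rewrite -EFinM; exact: fbox].
Qed.

Lemma leb_homothety_le (r : R) t A : 0 < r ->
  (leb ((fun x => (r *: x + t)%R) @` A) <= (r ^+ n)%:E * leb A)%E.
Proof.
move=> r0; apply: leb_image_le; first exact: exprn_gt0.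
move=> a b ab.
apply: (@le_trans _ _ (leb (box (r *: a + t) (r *: b + t)))).
  apply: le_leb => _ [x abx <-] i; have /andP[ax xb] := abx i.
  by rewrite !mxE ltrD2r lerD2r ltr_pM2l// ler_pM2l// ax.
apply: le_trans (leb_box _) _ => [i|].
  by rewrite !mxE lerD2r ler_pM2l.
rewrite lee_fin /box_volume -[n in r ^+ n]card_ord -prodr_const -big_split/=.
rewrite le_eqVlt; apply/orP; left; apply/eqP/eq_bigr => i _.
by rewrite !mxE mulrBr opprD addrACA subrr addr0.
Qed.

(** Any box is covered by a grid of cubes of side [d] whose total volume is
    at most that of the box with sides enlarged by [d]. *)
Lemma leb_image_box_cubes (f : V -> V) (c d : R) a b : 0 <= c -> 0 < d ->
    (forall t, (leb (f @` box t (t + const_mx d)) <= (c * d ^+ n)%:E)%E) ->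
    (forall i, a 0 i <= b 0 i) ->
  (leb (f @` box a b) <= (c * \prod_(i < n) (b 0 i - a 0 i + d))%:E)%E.
Proof.
move=> c0 d0 fcube ab.
pose N i := (Num.truncn ((b 0 i - a 0 i) / d)).+1.
have N_itv i : (N i).-1%:R * d <= b 0 i - a 0 i < (N i)%:R * d.
  rewrite -ler_pdivlMr// -ltr_pdivrMr//; apply: truncn_itv.
  by rewrite divr_ge0 ?subr_ge0// ltW.
pose m := \max_i N i.
have Nm i : (N i <= m)%N by exact: leq_bigmax.
pose Q (i : 'I_n) := [pred j : 'I_m | (j < N i)%N].
pose cube (g : {ffun 'I_n -> 'I_m}) : set V :=
  let t := \row_i (a 0 i + (g i)%:R * d) in box t (t + const_mx d).
apply: (@le_trans _ _ (\sum_(g in family Q) leb (f @` cube g))%E).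
  apply: leb_le_sum => _ [x abx <-].
  have /choice[g gP] i : exists j : 'I_m,
      Q i j /\ a 0 i + j%:R * d < x 0 i <= a 0 i + j%:R * d + d.
    have /andP[ax xb] := abx i.
    (* Cubes are open on the left, hence the least [k] such that the [k.+1]-st
       grid value is not exceeded. *)
    pose P k := x 0 i - a 0 i <= k.+1%:R * d.
    have P_N : P (N i).-1.
      have /andP[_ /ltW] := N_itv i; apply: le_trans; exact: lerB.
    have exP : exists k, P k by exists (N i).-1.
    case: (ex_minnP exP) => k Pk mink.
    have kN : (k < N i)%N by exact: mink P_N.
    exists (Ordinal (leq_trans kN (Nm i))); split=> //=.
    move: Pk; rewrite /P -natr1 mulrDl mul1r lerBlDl addrA => ->.
    rewrite andbT -ltrBrDl; case: k {kN} mink => [|k] mink.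
      by rewrite mul0r subr_gt0.
    by rewrite ltNge; apply/negP => /mink; rewrite ltnn.
  exists [ffun i => g i]; split.
  - exact: mem_index_enum.
  - by apply/familyP => i; rewrite ffunE; case: (gP i).
  - by exists x => // i; rewrite !mxE ffunE; case: (gP i).
apply: (@le_trans _ _ (\sum_(g in family Q) (c * d ^+ n)%:E)%E).
  by apply: lee_sum => g _; exact: fcube.
rewrite sumEFin lee_fin -mulr_sumr ler_wpM2l//.
have -> : \sum_(g in family Q) d ^+ n =
    \prod_(i < n) \sum_(j < m | Q i j) d.
  rewrite bigA_distr_big_dep; apply: eq_bigr => g _.
  by rewrite prodr_const card_ord.
apply: ler_prod => i _.
have -> : \sum_(j < m | Q i j) d = (N i)%:R * d.
  rewrite -(big_ord_widen m (fun=> d))//.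
  by rewrite sumr_const card_ord mulr_natl.
rewrite mulr_ge0 ?(ltW d0)//=.
have /andP[le _] := N_itv i.
by rewrite -[(N i)]/((N i).-1.+1) -natr1 mulrDl mul1r lerD2r.
Qed.

Lemma leb_image_box (f : V -> V) (c : R) a b : 0 <= c ->
    (forall t d, 0 < d ->
      (leb (f @` box t (t + const_mx d)) <= (c * d ^+ n)%:E)%E) ->
    (forall i, a 0 i <= b 0 i) ->
  (leb (f @` box a b) <= (c * box_volume a b)%:E)%E.
Proof.
move=> c0 fcube ab.
have le d : 0 < d ->
    (leb (f @` box a b) <= (c * \prod_(i < n) (b 0 i - a 0 i + d))%:E)%E.
  by move=> d0; apply: leb_image_box_cubes => // t; exact: fcube.
have : leb (f @` box a b) \is a fin_num.
  by rewrite ge0_fin_numE ?leb_ge0// (le_lt_trans (le 1 ltr01)) ?ltry.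
move=> /fineK; set v := fine _ => vE; rewrite -vE lee_fin.
pose g (d : R) := c * \prod_(i < n) (b 0 i - a 0 i + d).
have g_cvg : g d @[d --> (0 : R)^'+] --> g 0.
  apply: cvg_at_right_filter; apply: cvgMr.
  have : continuous (fun d : R => \prod_(i < n) (b 0 i - a 0 i + d)).
    apply: continuous_big; first exact: mul_continuous.
    by move=> i _ d; apply: cvgD; [exact: cvg_cst|exact: cvg_id].
  exact.
have -> : c * box_volume a b = g 0.
  by congr (c * _); apply: eq_bigr => i _; rewrite addr0.
apply: (ler_cvg_to (cvg_cst v) g_cvg).
near=> d; rewrite -lee_fin vE; apply: le.
by near: d; exact: nbhs_right_gt.
Unshelve. all: by end_near. Qed.

End Similarities.

(** * Rotations and similarities *)

Section Rotations.
Variables (R : realType) (n' : nat).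
Local Notation n := n'.+1.
Local Notation V := 'rV[R]_n.
Implicit Types (a b x y t : V) (A B : set V) (Q : 'M[R]_n).

Local Notation unit_cube := (box (const_mx (-1)) (const_mx 1) : set V).
Local Notation unit_ball := ([set x | enorm x < 1] : set V).

Lemma box_volume_const (r : R) :
  box_volume (const_mx (- r) : V) (const_mx r) = (2 * r) ^+ n.
Proof.
rewrite /box_volume -[n in RHS]card_ord -prodr_const.
by apply: eq_bigr => i _; rewrite !mxE opprK mulr_natl mulr2n.
Qed.

Lemma leb_unit_cube : (leb unit_cube <= (2 ^+ n)%:E)%E.
Proof.
have := @leb_box R n' (const_mx (-1)) (const_mx 1).
by rewrite box_volume_const mulr1; apply=> i; rewrite !mxE; lra.
Qed.

Lemma caratheodory_unit_ball : caratheodory_measurable (@leb R n) unit_ball.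
Proof.
apply: caratheodory_open.
rewrite (_ : unit_ball = @enorm R n @^-1` [set r | r < 1])//.
by apply: open_comp; [move=> *; exact: enorm_continuous|exact: open_lt].
Qed.

Lemma unit_ball_sub_cube : unit_ball `<=` unit_cube.
Proof.
move=> x /= x1 i; rewrite !mxE.
have := le_lt_trans (ler_coord_enorm x i) x1.
by rewrite ltr_norml => /andP[-> /ltW].
Qed.

Lemma enorm_unit_cube x : unit_cube x -> enorm x <= n%:R.
Proof.
move=> xcube; apply: le_trans (enorm_le_sum x) _.
rewrite -[n in n%:R]card_ord -sumr_const; apply: ler_sum => i _.
by have := xcube i; rewrite !mxE ler_norml => /andP[/ltW-> ->].
Qed.

(** The cube [unit_cube] lies in a multiple of [unit_ball], so it is null if
    the ball is. *)
Lemma leb_unit_cube_null : leb unit_ball = 0%E -> leb unit_cube = 0%E.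
Proof.
move=> ball0; apply/eqP; rewrite eq_le leb_ge0 andbT.
have n0 : 0 < n.+1%:R :> R by rewrite ltr0n.
have := leb_homothety_le 0 unit_ball n0; rewrite ball0 mule0.
apply: le_trans; apply: le_leb => x xcube; exists (n.+1%:R^-1 *: x).
  rewrite /= enormZ ?invr_ge0 ?ltW// mulrC ltr_pdivrMr// mul1r.
  by rewrite (le_lt_trans (enorm_unit_cube xcube))// ltr_nat.
by rewrite addr0 scalerA mulfV ?scale1r// gt_eqF.
Qed.

(** The outer measure of a rotated cube is proportional to the volume of the
    cube, with a factor [c] that does not depend on the cube; hence a rotation
    increases the outer measure of any set by at most the factor [c]. Applied
    to [unit_cube] minus [unit_ball], this bound forces [c <= 1], because the
    ball is invariant under the rotation. *)
Lemma leb_rotation_cube Q : Q *m Q^T = 1%:M ->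
  exists2 c : R, 0 <= c <= 1 & forall t d, 0 < d ->
    (leb (mulmxr Q @` box t (t + const_mx d)) <= (c * d ^+ n)%:E)%E.
Proof.
move=> QQ; pose f : V -> V := mulmxr Q.
have f_cube_fin : leb (f @` unit_cube) \is a fin_num.
  rewrite ge0_fin_numE ?leb_ge0//.
  apply: (@le_lt_trans _ _ (leb (box (const_mx (- n.+1%:R)) (const_mx n.+1%:R)
    : set V))).
    apply: le_leb => _ [x /enorm_unit_cube xn <-] i; rewrite !mxE.
    have : `|f x 0 i| < n.+1%:R.
      apply: le_lt_trans (ler_coord_enorm _ _) _.
      by rewrite enorm_mul_orthogonal// (le_lt_trans xn)// ltr_nat.
    by rewrite /f /= mxE ltr_norml => /andP[-> /ltW].
  apply: le_lt_trans (leb_box _) _; last by rewrite ltry.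
  by move=> i; rewrite !mxE lerNl (le_trans _ (ler0n _ _))// oppr_le0 ler0n.
(* The volume of [unit_cube] is [2 ^+ n]. *)
pose c := fine (leb (f @` unit_cube)) / 2 ^+ n.
have pow2 : 0 < 2 ^+ n :> R by exact: exprn_gt0.
have c_cube : leb (f @` unit_cube) = (c * 2 ^+ n)%:E.
  by rewrite /c divfK ?gt_eqF// fineK.
have c0 : 0 <= c by rewrite divr_ge0 ?(ltW pow2)// fine_ge0// leb_ge0.
have fcube t d : 0 < d ->
    (leb (f @` box t (t + const_mx d)) <= (c * d ^+ n)%:E)%E.
  move=> d0; have d20 : 0 < d / 2 by rewrite divr_gt0.
  have := leb_homothety_le (f (t + const_mx (d / 2))) (f @` unit_cube) d20.
  rewrite c_cube -EFinM mulrCA -exprMn divfK ?pnatr_eq0//.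
  apply: le_trans; apply: le_leb => _ [x xt <-].
  pose y := (2 / d) *: (x - t) - const_mx 1.
  exists (f y); first (exists y => // i).
    have /andP[lt le] := xt i; rewrite !mxE in lt le *.
    rewrite ltrBrDl subrr mulr_gt0 ?divr_gt0 ?subr_gt0//=.
    by rewrite lerBlDl mulrAC ler_pdivrMr// -natr1 ler_pM2l// lerBlDl.
  rewrite /f /= scalemxAl -mulmxDl; congr (_ *m _).
  apply/rowP => i; rewrite !mxE; field; exact: lt0r_neq0.
exists c => //; rewrite c0 leNgt; apply/negP => c1.
have fle A : (leb (f @` A) <= c%:E * leb A)%E.
  apply: leb_image_le => [|a b ab]; first exact: lt_trans c1.
  exact: leb_image_box.
(* If [1 < c], the ball is null, hence so are the cube and its image, which
   contradicts [c_cube]. *)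
suff ball0 : leb unit_ball = 0%E.
  have := fle unit_cube; rewrite leb_unit_cube_null// mule0 c_cube lee_fin.
  by rewrite leNgt mulr_gt0// (lt_trans _ c1).
have cubeE : leb unit_cube =
    (leb unit_ball + leb (unit_cube `&` ~` unit_ball))%E.
  rewrite [LHS]caratheodory_unit_ball; congr (leb _ + _)%E.
  by rewrite setIC; apply/setIidl; exact: unit_ball_sub_cube.
have fin A : A `<=` unit_cube -> leb A = (fine (leb A))%:E.
  move=> /le_leb Acube; rewrite fineK// ge0_fin_numE ?leb_ge0//.
  by apply: le_lt_trans Acube (le_lt_trans leb_unit_cube (ltry _)).
have le_cube : (leb (f @` unit_cube) <=
    leb unit_ball + c%:E * leb (unit_cube `&` ~` unit_ball))%E.
  apply: (@le_trans _ _
      (leb unit_ball + leb (f @` (unit_cube `&` ~` unit_ball)))%E).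
    apply: le_trans (outer_measureU2 _ _ _); apply: le_leb => _ [x xcube <-].
    have [xball|xball] := pselect (unit_ball x); [left|right]; last by exists x.
    by rewrite /= enorm_mul_orthogonal.
  by rewrite leeD2l.
have le_pow := leb_unit_cube.
move: cubeE le_cube le_pow; rewrite c_cube (fin unit_cube)//.
rewrite (fin _ unit_ball_sub_cube) (fin (_ `&` _)); last exact: subIsetl.
set p := fine (leb unit_ball); set q := fine (leb (_ `&` _)).
have p0 : 0 <= p by rewrite fine_ge0// leb_ge0.
rewrite -EFinM -!EFinD => -[->]; rewrite !lee_fin => le1 le2.
congr _%:E; apply/eqP; rewrite eq_le p0 andbT.
rewrite -(@pmulr_rle0 _ (c - 1)) ?subr_gt0//.
have : c * (p + q) <= c * 2 ^+ n by rewrite ler_wpM2l.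
rewrite mulrDr mulrBl mul1r; lra.
Qed.

Lemma leb_similarity_le (r : R) Q t A : 0 < r -> Q *m Q^T = 1%:M ->
  (leb ((fun x => (r *: (x *m Q) + t)%R) @` A) <= (r ^+ n)%:E * leb A)%E.
Proof.
move=> r0 QQ.
have := leb_homothety_le t (mulmxr Q @` A) r0; rewrite image_comp.
move=> /le_trans; apply; apply: lee_wpmul2l.
  by rewrite lee_fin exprn_ge0// ltW.
rewrite -[leRHS]mul1e; apply: leb_image_le => // a b ab.
have [c /andP[c0 c1] cubeP] := leb_rotation_cube QQ.
apply: le_trans (leb_image_box c0 cubeP ab) _.
by rewrite lee_fin ler_wpM2r// box_volume_ge0.
Qed.

(** A similarity of ratio [r] multiplies the outer measure by [r ^+ n]: both
    inequalities come from [leb_similarity_le], for the map and its inverse. *)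
Lemma leb_similarity (r : R) Q t A : 0 < r -> Q *m Q^T = 1%:M ->
  leb ((fun x => (r *: (x *m Q) + t)%R) @` A) = ((r ^+ n)%:E * leb A)%E.
Proof.
move=> r0 QQ; set f := fun x => _.
apply/eqP; rewrite eq_le leb_similarity_le//=.
have QTQ : Q^T *m Q^T^T = 1%:M by rewrite trmxK; exact: mulmx1C.
have := leb_similarity_le (- (r^-1 *: (t *m Q^T))) (f @` A) _ QTQ.
move=> /(_ r^-1); rewrite invr_gt0 r0 => /(_ isT).
rewrite -lee_pdivlMl ?exprn_gt0// -exprVn; apply: le_trans.
apply: le_leb => x Ax; exists (f x); first by exists x.
rewrite /f mulmxDl scalerDr addrK -scalemxAl scalerA mulVf ?gt_eqF//.
by rewrite scale1r -mulmxA QQ mulmx1.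
Qed.

End Rotations.

(** * Diameters, similarities and the attractor *)

Section Diameter.
Variables (R : realType) (n : nat).
Local Notation V := 'rV[R]_n.
Implicit Types (x y : V) (A : set V).

Local Notation distances A :=
  [set d | exists x y, [/\ A x, A y & d = enorm (x - y)]].

Lemma ler_coord_norm x i : `|x 0 i| <= `|x|.
Proof.
rewrite (_ : `|x| = mx_norm x)// mx_normrE.
exact: (@le_bigmax _ _ _ _ (fun ij : 'I_1 * 'I_n => `|x ij.1 ij.2|) (0, i)).
Qed.

Lemma bounded_setE A : bounded_set A ->
  exists2 M, 0 < M & forall x, A x -> forall i, `|x 0 i| <= M.
Proof.
move=> [M [Mreal AM]]; exists (`|M| + 1); first by rewrite ltr_wpDl.
move=> x Ax i; apply: le_trans (ler_coord_norm x i) _; apply: (AM _ _ x Ax).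
by rewrite (le_lt_trans (ler_norm M))// ltrDl.
Qed.

Lemma sub_bounded_set A B : A `<=` B -> bounded_set B -> bounded_set A.
Proof.
move=> AB [M [Mreal BM]]; exists M; split=> // r /BM Br x /AB; exact: Br.
Qed.

Lemma bounded_distances A : bounded_set A -> has_ubound (distances A).
Proof.
move=> /bounded_setE[M M0 AM]; exists (\sum_(i < n) (M + M)).
move=> _ [x [y [/AM Ax /AM Ay ->]]]; apply: le_trans (enorm_le_sum _) _.
apply: ler_sum => i _; rewrite !mxE; apply: le_trans (ler_normB _ _) _.
exact: lerD.
Qed.

Lemma le_diam A x y : has_ubound (distances A) -> A x -> A y ->
  enorm (x - y) <= diam A.
Proof. by move=> bA Ax Ay; apply: ub_le_sup => //; exists x, y. Qed.

Lemma diam_gt0_nonempty A : 0 < diam A -> A !=set0.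
Proof.
move=> d0; apply/set0P/eqP => A0; move: d0; rewrite /diam A0.
rewrite (_ : [set _ | _] = set0) ?sup0 ?ltxx//.
by apply/seteqP; split=> // d [x [y []]].
Qed.

Lemma diam_image (f : V -> V) (r : R) A : 0 < r -> A !=set0 ->
    (forall x y, enorm (f x - f y) = r * enorm (x - y)) ->
    has_ubound (distances A) ->
  diam (f @` A) = r * diam A.
Proof.
move=> r0 [x0 Ax0] fr bA.
have bfA : has_ubound (distances (f @` A)).
  exists (r * diam A) => _ [_ [_ [[x Ax <-] [y Ay <-] ->]]].
  by rewrite fr ler_pM2l// le_diam.
apply/eqP; rewrite eq_le; apply/andP; split.
  apply: ge_sup; first by exists (enorm (f x0 - f x0)), (f x0), (f x0);
    split=> //; exists x0.
  move=> _ [_ [_ [[x Ax <-] [y Ay <-] ->]]].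
  by rewrite fr ler_pM2l// le_diam.
rewrite -ler_pdivlMl//; apply: ge_sup.
  by exists (enorm (x0 - x0)), x0, x0.
move=> _ [x [y [Ax Ay ->]]]; rewrite ler_pdivlMl// -fr.
by apply: le_diam.
Qed.

End Diameter.

Section SimilarityMaps.
Variables (R : realType) (n : nat).
Local Notation V := 'rV[R]_n.
Implicit Types (s : contracting_similarity R n) (x y : V) (U : set V).

(** The inverse of the similarity [s], which is again a similarity. *)
Definition sim_inv s y : V := (ratio s)^-1 *: ((y - shift s) *m orth s).

Lemma orth_tr s : (orth s)^T *m (orth s)^T^T = 1%:M.
Proof. by rewrite trmxK; apply: mulmx1C; exact: orth_orthogonal. Qed.

Lemma sim_funK s : cancel s (sim_inv s).
Proof.
move=> x; rewrite /sim_inv /sim_fun addrK -scalemxAl scalerA.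
rewrite mulVf ?gt_eqF ?ratio_gt0// scale1r -mulmxA.
by have := orth_tr s; rewrite trmxK => ->; rewrite mulmx1.
Qed.

Lemma sim_invK s : cancel (sim_inv s) s.
Proof.
move=> y; rewrite /sim_inv /sim_fun -scalemxAl scalerA.
rewrite mulfV ?gt_eqF ?ratio_gt0// scale1r -mulmxA orth_orthogonal mulmx1.
by rewrite subrK.
Qed.

Lemma enorm_sim s x y : enorm (s x - s y) = ratio s * enorm (x - y).
Proof.
rewrite /sim_fun opprD addrACA subrr addr0 -scalerBr -mulmxBl.
by rewrite enormZ ?ltW ?ratio_gt0// enorm_mul_orthogonal// orth_tr.
Qed.

Lemma open_sim s U : open U -> open (s @` U).
Proof.
move=> /open_enormP Uo; apply/open_enormP => _ [x Ux <-].
have [e e0 xU] := Uo x Ux; exists (ratio s * e).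
  by rewrite mulr_gt0 ?ratio_gt0.
move=> y; rewrite -(sim_invK s y) enorm_sim ltr_pM2l ?ratio_gt0// => /xU Uy.
by exists (sim_inv s y).
Qed.

End SimilarityMaps.

(** The product of the ratios along a word; when [rho i] is the ratio of [s i],
    this is the ratio of the similarity [word_map s m]. *)
Definition word_ratio (R : realType) (I : Type) (rho : I -> R)
    (m : seq I) : R :=
  \prod_(i <- m) rho i.

Section WordMaps.
Variables (R : realType) (n M : nat) (s : 'I_M -> contracting_similarity R n).
Local Notation V := 'rV[R]_n.
Local Notation rho := (fun i => ratio (s i)).
Implicit Types (x y : V) (A U : set V) (m w : seq 'I_M).

Lemma piece_nil A : piece s A [::] = A.
Proof. exact: image_id. Qed.

Lemma piece_cons A i m : piece s A (i :: m) = s i @` piece s A m.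
Proof. by rewrite /piece /= image_comp. Qed.

Lemma word_ratio_gt0 m : 0 < word_ratio rho m.
Proof. by apply: prodr_gt0 => i _; exact: ratio_gt0. Qed.

Lemma enorm_word_map m x y :
  enorm (word_map s m x - word_map s m y) = word_ratio rho m * enorm (x - y).
Proof.
elim: m => [|i m IH] /=; first by rewrite /word_ratio big_nil mul1r.
by rewrite enorm_sim IH /word_ratio big_cons mulrA.
Qed.

Lemma open_piece U m : open U -> open (piece s U m).
Proof.
move=> Uo; elim: m => [|i m IH]; first by rewrite piece_nil.
by rewrite piece_cons; exact: open_sim.
Qed.

Lemma piece_sub A m : (forall i, s i @` A `<=` A) -> piece s A m `<=` A.
Proof.
move=> sA; elim: m => [|i m IH]; first by rewrite piece_nil.
rewrite piece_cons => _ [x /IH Ax <-]; apply: (sA i); by exists x.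
Qed.

End WordMaps.

Section OpenSetCondition.
Variables (R : realType) (n M : nat) (s : 'I_M -> contracting_similarity R n).
Variable K : set 'rV[R]_n.
Hypothesis attrK : is_attractor s K.
Local Notation V := 'rV[R]_n.
Local Notation rho := (fun i => ratio (s i)).
Implicit Types (x y : V) (O U : set V).

Lemma attractor_bounded : bounded_set K.
Proof. by case: attrK => _ /compact_bounded. Qed.

Lemma sim_interior_attractor i : s i @` K° `<=` K°.
Proof.
have : s i @` K° `<=` K.
  move=> _ [x /interior_subset Kx <-]; case: attrK => _ _ ->.
  by exists i => //; exists x.
by rewrite open_subsetE//; apply: open_sim; exact: open_interior.
Qed.

Lemma attractor_word N x : K x ->
  exists m y, [/\ size m = N, K y & word_map s m y = x].
Proof.
elim: N x => [|N IH] x Kx; first by exists [::], x.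
have : (\bigcup_i (s i @` K)) x by case: attrK => _ _ <-.
move=> [i _ [y Ky <-]]; have [m [z [mN Kz <-]]] := IH _ Ky.
by exists (i :: m), z; rewrite /= mN.
Qed.

(** Points of [K] are images of points of [K] under arbitrarily long words,
    and long words shrink the distance to a chosen point of [O]. *)
Lemma attractor_approx O x (e : R) : O !=set0 ->
    (forall i, s i @` O `<=` O) -> K x -> 0 < e ->
  exists2 p, O p & enorm (p - x) < e.
Proof.
move=> [p0 Op0] sO Kx e0.
have [C C0 KC] : exists2 C, 0 < C & forall y, K y -> enorm (p0 - y) <= C.
  have [B B0 KB] := bounded_setE attractor_bounded.
  exists (1 + \sum_(i < n) (`|p0 0 i| + B)).
    by rewrite ltr_pwDl// sumr_ge0// => i _; rewrite addr_ge0// ltW.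
  move=> y /KB yB; apply: le_trans (enorm_le_sum _) _.
  rewrite ler_wpDl//; apply: ler_sum => i _; rewrite !mxE.
  by apply: le_trans (ler_normB _ _) _; rewrite lerD2l.
pose q := \big[Num.max/0]_(i < M) ratio (s i).
have q0 : 0 <= q by exact: bigmax_ge_id.
have q1 : q < 1 by apply: bigmax_lt => // i _; exact: ratio_lt1.
have wq m : word_ratio rho m <= q ^+ size m.
  elim: m => [|i m IH]; first by rewrite /word_ratio big_nil.
  rewrite /word_ratio big_cons /= exprS ler_pM//.
  - exact/ltW/ratio_gt0.
  - exact/ltW/word_ratio_gt0.
  - exact: (le_bigmax _ (fun i => ratio (s i)) i).
have [N qN] : exists N, q ^+ N * C < e.
  have /cvg_expr : `|q| < 1 by rewrite ger0_norm.
  move=> /cvgr0Pnorm_lt /(_ (e / C)); rewrite divr_gt0// => /(_ isT)[N _].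
  move=> /(_ N (leqnn N)); rewrite /= ger0_norm ?exprn_ge0// => qN.
  by exists N; rewrite -ltr_pdivlMr.
have [m [y [mN Ky <-]]] := attractor_word N Kx.
exists (word_map s m p0).
  by apply: (piece_sub sO (m := m)); exists p0.
rewrite enorm_word_map; apply: le_lt_trans qN.
by apply: ler_pM; rewrite ?enorm_ge0 ?KC ?(ltW (word_ratio_gt0 _ _)) -?mN.
Qed.

(** The images of [K°] are disjoint because [K] lies in the closure of the open
    set [U] of the condition. If the images of [K°] under [s i] and [s j] met,
    their intersection, being open, would meet [s i @` U], and the intersection
    of [s j @` K°] with [s i @` U] would in turn meet [s j @` U]. *)
Lemma disjoint_interior_attractor i j : open_set_condition s -> i != j ->
  s i @` K° `&` s j @` K° = set0.
Proof.
move=> [U [U0 Uo sU disjU]] ij.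
have {}sU k : s k @` U `<=` U.
  by move=> x sx; apply: sU; exists k.
have meet k W : open W -> W `&` s k @` K° !=set0 -> W `&` s k @` U !=set0.
  move=> /open_enormP Wo [y [Wy [x Kx xy]]]; rewrite -{y}xy in Wy.
  have [e e0 We] := Wo _ Wy.
  have [p Up px] := attractor_approx U0 sU (interior_subset Kx) e0.
  exists (s k p); split; last by exists p.
  apply: We; rewrite enorm_sim; apply: le_lt_trans px.
  by rewrite ler_piMl ?enorm_ge0// ltW// ratio_lt1.
apply/eqP/negPn/negP => /set0P KK.
have oK k : open (s k @` K°) by apply: open_sim; exact: open_interior.
have [x [Kx Ux]] := meet j _ (oK i) KK.
have [y [Uy Ux']] : s j @` U `&` s i @` U !=set0.
  by apply: meet; [exact: open_sim|exists x].
by have : (s i @` U `&` s j @` U) y by []; rewrite disjU.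
Qed.

End OpenSetCondition.

(** * Cut sets of words *)

Section CutSets.
Variables (R : realType) (I : finType) (rho : I -> R).
Hypotheses (rho_gt0 : forall i, 0 < rho i) (rho_lt1 : forall i, rho i < 1).
Implicit Types (m w : seq I) (t : R).

(** The words at which the ratio, followed letter by letter from the empty
    word, first drops to [t] or below. *)
Definition cutset t : set (seq I) :=
  if 1 <= t then [set [::]]
  else [set m | exists w i,
    [/\ m = rcons w i, word_ratio rho m <= t & t < word_ratio rho w]].

Lemma word_ratio_nil : word_ratio rho [::] = 1.
Proof. exact: big_nil. Qed.

Lemma word_ratio_cons i m :
  word_ratio rho (i :: m) = rho i * word_ratio rho m.
Proof. exact: big_cons. Qed.

Lemma word_ratio_rcons m i :
  word_ratio rho (rcons m i) = word_ratio rho m * rho i.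
Proof. by rewrite /word_ratio -cats1 big_cat big_seq1. Qed.

Lemma word_ratio_le1 m : word_ratio rho m <= 1.
Proof.
elim: m => [|i m IH]; first by rewrite word_ratio_nil.
rewrite word_ratio_cons; apply: le_trans (ltW (rho_lt1 i)).
by rewrite ler_piMr// ltW.
Qed.

Lemma cutset_ge1 t : 1 <= t -> cutset t = [set [::]].
Proof. by rewrite /cutset => ->. Qed.

Lemma cutset_not_nil t : t < 1 -> ~ cutset t [::].
Proof. by rewrite /cutset leNgt => -> /= -[[|j w] [i []]]. Qed.

Lemma cutset_cons t i m : t < 1 -> cutset t (i :: m) <-> cutset (t / rho i) m.
Proof.
move=> t1; rewrite /cutset leNgt t1 /=.
have [t_i|i_t] := leP 1 (t / rho i).
  rewrite ler_pdivlMr// mul1r in t_i; split=> [[[|j w] [k []]]|->].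
  - by case=> _ ->.
  - move=> [<- _] _ /=; rewrite word_ratio_cons ltNge => /negP[].
    by apply: le_trans t_i; rewrite ler_piMr ?word_ratio_le1// ltW.
  - by exists [::], i; rewrite /= word_ratio_cons word_ratio_nil mulr1.
rewrite ltr_pdivrMr// mul1r in i_t.
split=> [[[|j w] [k []]]|[w [j [-> le lt]]]].
- case=> _ ->; rewrite word_ratio_cons word_ratio_nil mulr1 => it.
  by rewrite leNgt i_t in it.
- move=> [<- ->]; rewrite -rcons_cons !word_ratio_cons => le lt.
  by exists w, k; rewrite ler_pdivlMr// ltr_pdivrMr// ![_ * rho i]mulrC.
- exists (i :: w), j; split=> //.
    by rewrite word_ratio_cons mulrC -ler_pdivlMr.
  by rewrite word_ratio_cons mulrC -ltr_pdivrMr.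
Qed.

(** Induction along [cutset_cons]; it is well founded because each step divides
    the threshold by a ratio bounded away from [1]. *)
Lemma cutset_ind (P : R -> Prop) :
    (forall t, 1 <= t -> P t) ->
    (forall t, 0 < t -> t < 1 -> (forall i, P (t / rho i)) -> P t) ->
  forall t, 0 < t -> P t.
Proof.
move=> P1 Pstep t t0.
pose q := \big[Num.max/0]_i rho i.
have q0 : 0 <= q by exact: bigmax_ge_id.
have q1 : q < 1 by exact: bigmax_lt.
have [k qk] : exists k, q ^+ k <= t.
  have /cvg_expr : `|q| < 1 by rewrite ger0_norm.
  move=> /cvgr0Pnorm_lt /(_ _ t0)[k _] /(_ k (leqnn k)).
  by rewrite /= ger0_norm ?exprn_ge0// => /ltW ?; exists k.
elim: k t t0 qk => [|k IH] t t0 qk; first exact: P1.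
have [|t1] := leP 1 t; first exact: P1.
apply: Pstep => // i; apply: IH; first by rewrite divr_gt0.
rewrite ler_pdivlMr//; apply: le_trans qk; rewrite exprSr.
by rewrite ler_wpM2l ?exprn_ge0//; exact: (le_bigmax _ rho i).
Qed.

(** If the weights [rho i ^+ n] sum to [1], a cut set is finite and its words
    carry total weight [1]: those that start with the letter [i] carry weight
    [rho i ^+ n]. *)
Lemma cutset_enum n t : \sum_i rho i ^+ n = 1 -> 0 < t ->
  exists r : seq (seq I), [/\ uniq r, forall m, m \in r <-> cutset t m
    & \sum_(m <- r) word_ratio rho m ^+ n = 1].
Proof.
move=> rho1; move: t; apply: cutset_ind => [t t1|t t0 t1 /choice[r rP]].
  exists [:: [::]]; split=> //; last by rewrite big_seq1 word_ratio_nil expr1n.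
  by move=> m; rewrite cutset_ge1// inE; split=> [/eqP|->].
exists [seq i :: m | i <- enum I, m <- r i]; split.
- apply: allpairs_uniq_dep; [exact: enum_uniq|by move=> i _; case: (rP i)|].
  by move=> [i m] [j w] _ _ /= [-> ->].
- move=> m; split=> [/allpairsPdep[i [w [_ wr ->]]]|].
    by apply/cutset_cons => //; case: (rP i) => _ rE _; exact/rE.
  case: m => [/cutset_not_nil//|i m /(cutset_cons _ _ t1) tm].
  apply/allpairsPdep; exists i, m; split=> //; first by rewrite mem_enum.
  by case: (rP i) => _ rE _; exact/rE.
- rewrite big_allpairs_dep big_enum /= -[RHS]rho1; apply: eq_bigr => i _.
  under eq_bigr do rewrite word_ratio_cons exprMn.
  by rewrite -mulr_sumr; case: (rP i) => _ _ ->; rewrite mulr1.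
Qed.

Lemma cutset_ratio_le t m : cutset t m -> t <= 1 -> word_ratio rho m <= t.
Proof.
rewrite /cutset; case: (leP 1 t) => [t1 ->|_ [w [i []]]//].
by rewrite word_ratio_nil.
Qed.

Lemma cutset_ratio_gt (rmin : R) t m : 0 < t -> t <= 1 -> rmin < 1 ->
  (forall i, rmin <= rho i) -> cutset t m -> rmin * t < word_ratio rho m.
Proof.
move=> t0 t1 rmin1 rminE; rewrite /cutset; case: (leP 1 t) => [t1' ->|t1'].
  rewrite word_ratio_nil; apply: lt_le_trans t1.
  by rewrite gtr_pMl.
move=> [w [i [-> _ tw]]]; rewrite word_ratio_rcons mulrC.
apply: (@le_lt_trans _ _ (t * rho i)); first by rewrite ler_pM2l.
by rewrite ltr_pM2r.
Qed.

End CutSets.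

(** * Measure and disjointness of the pieces *)

Section MeasureOfPieces.
Variables (R : realType) (n' M : nat).
Local Notation n := n'.+1.
Variables (s : 'I_M -> contracting_similarity R n) (K : set 'rV[R]_n).
Hypothesis attrK : is_n_attractor s K.
Local Notation V := 'rV[R]_n.
Local Notation rho := (fun i => ratio (s i)).
Local Notation Om := (K° : set V).

Let rho_gt0 i : 0 < rho i. Proof. exact: ratio_gt0. Qed.
Let rho_lt1 i : rho i < 1. Proof. exact: ratio_lt1. Qed.
Let isK : is_attractor s K. Proof. by case: attrK. Qed.
Let sum_rho : \sum_i rho i ^+ n = 1. Proof. by case: attrK. Qed.

Lemma leb_sim (A : set V) i :
  leb (s i @` A) = ((ratio (s i) ^+ n)%:E * leb A)%E.
Proof.
by rewrite -(leb_similarity (shift (s i)) A (rho_gt0 i) (orth_tr (s i))).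
Qed.

Lemma leb_piece (A : set V) m :
  leb (piece s A m) = ((word_ratio rho m ^+ n)%:E * leb A)%E.
Proof.
elim: m => [|i m IH]; first by rewrite piece_nil word_ratio_nil expr1n mul1e.
by rewrite piece_cons leb_sim IH muleA -EFinM word_ratio_cons exprMn.
Qed.

Lemma leb_bounded_fin_num (A : set V) : bounded_set A -> leb A \is a fin_num.
Proof.
move=> /bounded_setE[B B0 AB]; rewrite ge0_fin_numE ?leb_ge0//.
pose C := B + 1; have C0 : 0 < C by rewrite addr_gt0.
apply: (@le_lt_trans _ _ (leb (box (const_mx (- C)) (const_mx C) : set V))).
  apply: le_leb => x Ax i; rewrite !mxE.
  have : `|x 0 i| < C by rewrite (le_lt_trans (AB x Ax i))// ltrDl.
  by rewrite ltr_norml => /andP[-> /ltW].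
by apply: le_lt_trans (leb_box _) (ltry _) => i; rewrite !mxE ge0_cp// ltW.
Qed.

Lemma leb_bigsetU_disjoint (I : eqType) (r : seq I) (F : I -> set V) :
    uniq r -> (forall i, open (F i)) ->
    (forall i j, i != j -> F i `&` F j = set0) ->
  leb (\big[setU/set0]_(i <- r) F i) = (\sum_(i <- r) leb (F i))%E.
Proof.
move=> + Fo FF; elim: r => [|i r IH]; first by rewrite !big_nil leb0.
rewrite /= => /andP[ir ur]; rewrite !big_cons -IH//.
have cF := caratheodory_open (Fo _).
have cU : caratheodory_measurable (@leb R n) (\big[setU/set0]_(j <- r) F j).
  elim/big_ind: _ => //; first exact: caratheodory_measurable_set0.
  exact: caratheodory_measurable_setU.
have := @disjoint_caratheodoryIU _ _ (@leb R n) _ _ (cF i) cU setT.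
rewrite !setTI; apply; apply/eqP.
elim: r ir {IH ur cU} => [|j r IH]; first by rewrite big_nil setI0.
rewrite inE negb_or big_cons => /andP[ij ir].
by rewrite setIUr FF// set0U IH.
Qed.

(** The sets [s i @` Om] are disjoint subsets of [Om] whose measures add up to
    the finite measure of [Om]. *)
Lemma leb_complement_first_level :
  leb (Om `\` \big[setU/set0]_i (s i @` Om)) = 0%E.
Proof.
have Omfin : leb Om \is a fin_num.
  apply: leb_bounded_fin_num; apply: sub_bounded_set (attractor_bounded isK).
  exact: interior_subset.
have so i : open (s i @` Om) by apply: open_sim; exact: open_interior.
set U := \big[setU/set0]_i _.
have Uo : open U.
  rewrite /U; elim/big_ind: _ => [|A B|i _]; last exact: so.
    exact: open0.
  exact: openU.
have UOm : U `<=` Om.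
  rewrite /U; elim/big_ind: _ => //; first by move=> A B AO BO x [/AO|/BO].
  by move=> i _; exact: sim_interior_attractor.
have lebU : leb U = leb Om.
  rewrite leb_bigsetU_disjoint//; first last.
  - by move=> i j; apply: disjoint_interior_attractor => //; case: attrK.
  - exact: index_enum_uniq.
  under eq_bigr do rewrite leb_sim.
  rewrite -ge0_sume_distrl; last by move=> i _; rewrite lee_fin exprn_ge0// ltW.
  by rewrite sumEFin sum_rho mul1e.
have := caratheodory_open Uo Om; rewrite setIidr// -setDE lebU -(fineK Omfin).
case: (leb (Om `\` U)) (leb_ge0 (Om `\` U)) => [q _|//|//] [rq].
by congr _%:E; lra.
Qed.

Lemma leb_complement_cutset t : 0 < t ->
  leb (Om `\` \bigcup_(m in cutset rho t) piece s Om m) = 0%E.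
Proof.
move: t; apply: (cutset_ind rho_gt0 rho_lt1) => [t t1|t t0 t1 IH].
  by rewrite cutset_ge1// bigcup_set1 piece_nil setDv leb0.
pose N i := Om `\` \bigcup_(m in cutset rho (t / rho i)) piece s Om m.
apply/eqP; rewrite eq_le leb_ge0 andbT.
apply: (@le_trans _ _ (leb ((Om `\` \big[setU/set0]_i (s i @` Om)) `|`
    \big[setU/set0]_i (s i @` N i)))); last first.
  apply: le_trans (outer_measureU2 _ _ _) _.
  rewrite /= leb_complement_first_level add0e leb_null_bigsetU// => i _.
  by rewrite leb_sim IH mule0.
apply: le_leb => x [Ox xt].
have [xU|xU] := pselect ((\big[setU/set0]_i (s i @` Om)) x); [right|by left].
move: xU; rewrite -!bigcup_seq => -[i /= iI [y Oy yx]].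
exists i => //; exists y => //; split=> // -[m tm ym]; apply: xt.
exists (i :: m); first exact/cutset_cons.
by rewrite piece_cons; exists y.
Qed.

Lemma disjoint_pieces t m w : 0 < t ->
  cutset rho t m -> cutset rho t w -> m != w ->
  piece s Om m `&` piece s Om w = set0.
Proof.
move=> t0; move: t t0 m w.
apply: (cutset_ind rho_gt0 rho_lt1) => [t t1|t t0 t1 IH] m w.
  by rewrite cutset_ge1// => -> ->; rewrite eqxx.
case: m => [/cutset_not_nil//|i m /cutset_cons tm].
case: w => [/cutset_not_nil//|j w /cutset_cons tw].
rewrite !piece_cons => mw.
have [ij|ij] := eqVneq i j.
  rewrite -{}ij in tw mw *; rewrite eqseq_cons eqxx /= in mw.
  apply/seteqP; split=> // _ [[x mx <-] [y wy /(can_inj (@sim_funK _ _ _)) yx]].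
  have : (piece s Om m `&` piece s Om w) x by split=> //; rewrite -yx.
  by rewrite (IH i m w)//; [exact: tm|exact: tw].
have sub k v : s k @` piece s Om v `<=` s k @` Om.
  apply: image_subset; apply: piece_sub; exact: sim_interior_attractor.
apply/seteqP; split=> // x [/sub xi /sub xj].
have : (s i @` Om `&` s j @` Om) x by [].
by rewrite disjoint_interior_attractor//; case: attrK.
Qed.

End MeasureOfPieces.

(** * The mesh *)

Section Pieces.
Variables (R : realType) (n M : nat) (s : 'I_M -> contracting_similarity R n).
Local Notation V := 'rV[R]_n.
Local Notation rho := (fun i => ratio (s i)).
Implicit Types (A : set V).

Lemma diam_piece A m : bounded_set A -> A !=set0 ->
  diam (piece s A m) = word_ratio rho m * diam A.
Proof.
move=> bA A0; apply: diam_image => //; first exact: word_ratio_gt0.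
  exact: enorm_word_map.
exact: bounded_distances.
Qed.

Lemma Lh_cutset A h : bounded_set A -> 0 < diam A ->
  Lh s A h = cutset rho (h / diam A).
Proof.
move=> bA d0; have A0 := diam_gt0_nonempty d0.
rewrite /Lh /cutset ler_pdivlMr// mul1r; case: ifP => // _.
by apply/seteqP; split=> m [w [i [mE le lt]]]; exists w, i; split=> //;
  move: le lt; rewrite !diam_piece// ?ler_pdivlMr// ?ltr_pdivrMr//.
Qed.

Lemma ratio_min_le i : ratio_min s <= ratio (s i).
Proof. exact: (bigmin_le 1 i rho). Qed.

Lemma ratio_min_gt0 : 0 < ratio_min s.
Proof. by apply: lt_bigmin => // i _; exact: ratio_gt0. Qed.

End Pieces.

Theorem proposition4p12 (R : realType) (n M : nat)
    (s : 'I_M -> contracting_similarity R n) (K : set 'rV[R]_n) (h : R)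
    (n_gt0 : (0 < n)%N) (M_ge2 : (2 <= M)%N)
    (hK : is_n_attractor s K)
    (h_gt0 : 0 < h) (h_le : h <= diam (interior K)) :
  let Om := interior K in
  let rho_min := ratio_min s in
  let mesh := piece s Om @` Lh s Om h in
  [/\ is_mesh Om mesh,
      forall m, Lh s Om h m ->
        rho_min * h < diam (piece s Om m) /\ diam (piece s Om m) <= h,
      forall m, Lh s Om h m ->
        ((((rho_min * h / diam Om) ^+ n)%:E * leb Om <= leb (piece s Om m))%E /\
         (leb (piece s Om m) <= ((h / diam Om) ^+ n)%:E * leb Om)%E)
    & exists N : nat,
        [/\ (Lh s Om h #= `I_N)%card, (mesh #= `I_N)%card,
            (diam Om / h) ^+ n <= N%:R
          & N%:R < (diam Om / (rho_min * h)) ^+ n]].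
Proof.
case: n n_gt0 s K hK h_le => // n' _ s K hK h_le Om rho_min mesh.
have [isK _ sum_rho] := hK.
pose rho i := Defs.ratio (s i); pose d := diam Om; pose t := h / d.
have d0 : 0 < d by exact: lt_le_trans h_le.
have t0 : 0 < t by rewrite divr_gt0.
have t1 : t <= 1 by rewrite ler_pdivrMr// mul1r.
have tE : t * d = h by rewrite divfK// gt_eqF.
have Om0 := diam_gt0_nonempty d0.
have bOm : bounded_set Om.
  by apply: sub_bounded_set (attractor_bounded isK); exact: interior_subset.
have rho0 i : 0 < rho i by exact: ratio_gt0.
have rho1 i : rho i < 1 by exact: ratio_lt1.
have rmin0 : 0 < rho_min by exact: ratio_min_gt0.
have rminE i : rho_min <= rho i by exact: ratio_min_le.
have rmin1 : rho_min < 1.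
  exact: le_lt_trans (rminE (Ordinal (ltnW M_ge2))) (rho1 _).
have LE : Lh s Om h = cutset rho t by exact: Lh_cutset.
rewrite /mesh LE.
have ratio_lt m : cutset rho t m -> rho_min * t < word_ratio rho m.
  exact: cutset_ratio_gt.
have ratio_le m : cutset rho t m -> word_ratio rho m <= t.
  by move=> /cutset_ratio_le; exact.
have disj m w : cutset rho t m -> cutset rho t w -> m != w ->
    piece s Om m `&` piece s Om w = set0.
  exact: disjoint_pieces.
have piece0 m : piece s Om m !=set0.
  by have [x Ox] := Om0; exists (word_map s m x), x.
have piece_inj : set_inj (cutset rho t) (piece s Om).
  move=> m w /set_mem tm /set_mem tw mw.
  apply/eqP/negPn/negP => /(disj _ _ tm tw).
  by rewrite -mw setIid => p0; have [x] := piece0 m; rewrite p0.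
have [r [ur rE sum_r]] := cutset_enum rho0 rho1 sum_rho t0.
have cutE : cutset rho t = [set` r].
  by apply/seteqP; split=> m /=; rewrite rE.
have pieceOm m : piece s Om m `<=` Om.
  by apply: piece_sub; exact: sim_interior_attractor.
split.
- split.
  + by apply: finite_image; rewrite cutE; exact: finite_seq.
  + move=> _ [m _ <-]; split=> //.
    * exact: sub_bounded_set bOm.
    * by apply: open_piece; exact: open_interior.
  + move=> _ _ [m tm <-] [w tw <-] mw; apply: disj => //.
    by apply/eqP => mw'; apply: mw; rewrite mw'.
  + by rewrite bigcup_image; exact: leb_complement_cutset.
- move=> m tm; rewrite diam_piece// -tE mulrA; split.
    by rewrite ltr_pM2r// ratio_lt.
  by rewrite ler_pM2r// ratio_le.
- move=> m tm; rewrite leb_piece -mulrA -/d -/t; split;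
    apply: lee_wpmul2r; rewrite ?leb_ge0// lee_fin lerXn2r// ?nnegrE.
  + by rewrite mulr_ge0// ltW.
  + exact/ltW/word_ratio_gt0.
  + by rewrite ltW// ratio_lt.
  + exact/ltW/word_ratio_gt0.
  + exact: ltW.
  + exact: ratio_le.
- have cardL : (cutset rho t #= `I_(size r))%card.
    rewrite cutE (_ : [set` r] = nth [::] r @` `I_(size r)).
      apply: inj_card_eq => k l /set_mem kr /set_mem lr /eqP.
      by rewrite nth_uniq// => /eqP.
    apply/seteqP; split=> [m /= /(nthP [::])[k kr <-]|_ [k kr <-]].
      by exists k.
    exact: mem_nth.
  have sum_const c : \sum_(m <- r) c = (size r)%:R * c :> R.
    by rewrite big_const_seq count_predT iter_addr_0 mulr_natl.
  have r0 : has (fun m => m \in r) r.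
    case: r sum_r {ur rE cutE cardL sum_const} => [|m r _]; last first.
      by rewrite /= mem_head.
    by rewrite big_nil => /eqP; rewrite eq_sym oner_eq0.
  exists (size r); split=> //.
  + by apply: card_eq_trans cardL; exact: inj_card_eq.
  + rewrite -[d / h]invf_div -/t exprVn.
    rewrite -[leLHS]mulr1 ler_pdivrMl ?exprn_gt0// mulrC -sum_const -sum_r.
    rewrite big_seq [leRHS]big_seq; apply: ler_sum => m /rE tm.
    by rewrite lerXn2r ?nnegrE ?ratio_le// ltW// word_ratio_gt0.
  + have -> : d / (rho_min * h) = (rho_min * t)^-1.
      by rewrite /t mulrA invf_div.
    rewrite exprVn -[ltRHS]mulr1 ltr_pdivlMl; last first.
      by rewrite exprn_gt0// pmulr_rgt0.
    rewrite mulrC -sum_const -sum_r big_seq [ltRHS]big_seq.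
    apply: ltr_sum => // m /rE tm.
    by rewrite ltrXn2r// ?ratio_lt// mulr_ge0// ltW.
Qed.
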